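(* Let $n\ge1$, let $\lambda=(\lambda_1,\dots,\lambda_n)$ be a partition of length at most $n$, let $\eta=(\eta_1,\dots,\eta_{n+1})$ be a dimension elevation partition of $\lambda$, and let $0<a<b$. Let $P$ be a $\mathcal{E}_\lambda(n)$-function written in the Chebyshev-Bernstein bases of $\mathcal{E}_\lambda(n)$ and $\mathcal{E}_\eta(n+1)$ over $[a,b]$ as $$P(t)=\sum_{k=0}^nB^n_{k,\lambda}(t)P_k=\sum_{k=0}^{n+1}B^{n+1}_{k,\eta}(t)\tilde P_k .$$ Then $\tilde P_0=P_0$, $\tilde P_{n+1}=P_n$, and for $k=1,\dots,n$ $$\tilde P_k=\rho_{[\lambda,\eta]}(n,k-1)\,P_{k-1}+\xi_{[\lambda,\eta]}(n,k)\,P_k,$$ where $$\xi_{[\lambda,\eta]}(n,k)=\frac{(n+1-k)\,a^{\lambda_1-\eta_1}}{n+1}\binom{\eta}{\lambda}_{\!n}\Gamma_\lambda^\eta(n,k),\qquad \rho_{[\lambda,\eta]}(n,k)=\frac{(k+1)\,b^{\lambda_1-\eta_1}}{n+1}\binom{\eta}{\lambda}_{\!n}\Delta_\lambda^\eta(n,k).$$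
   Context: Partitions and Schur functions: a partition of length at most $n$ is a sequence of integers $\lambda_1\ge\dots\ge\lambda_n\ge0$; partitions differing only by trailing zeros are identified. For a partition $\nu$ of length at most $m$, $S_\nu(u_1,\dots,u_m)=\det(u_i^{\nu_j+m-j})_{1\le i,j\le m}/\det(u_i^{m-j})_{1\le i,j\le m}$ is the Schur polynomial (evaluated also at coinciding arguments). The notation $S_\nu(x^p,y^q)$ means that $x$ is repeated $p$ times and $y$ is repeated $q$ times. $f_\nu(m)=S_\nu(1^m)$ is the number of semi-standard Young tableaux of shape $\nu$ with entries at most $m$; $f_\emptyset(m)=1$. The bottom partition of $\nu=(\nu_1,\nu_2,\dots)$ is $\nu^{(0)}=(\nu_2,\nu_3,\dots)$. Müntz space: $\mathcal{E}_\lambda(n)$ is the span on $]0,\infty[$ of $1,t^{\lambda_1-\lambda_2+1},t^{\lambda_1-\lambda_3+2},\dots,t^{\lambda_1-\lambda_n+(n-1)},t^{\lambda_1+n}$. A partition $\eta$ of length at most $n+1$ is a dimension elevation partition of $\lambda$ (of length at most $n$) if $\mathcal{E}_\lambda(n)\subset\mathcal{E}_\eta(n+1)$. A $\mathcal{E}_\lambda(n)$-function is a map $P:\,]0,\infty[\,\to\mathbb{R}^m$ ($m\le n$) all of whose components lie in $\mathcal{E}_\lambda(n)$; the coefficients $P_k,\tilde P_k$ are points of $\mathbb{R}^m$. Chebyshev-Bernstein basis $(B^n_{0,\lambda},\dots,B^n_{n,\lambda})$ of $\mathcal{E}_\lambda(n)$ over $[a,b]\subset\,]0,\infty[$: the unique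 basis of $\mathcal{E}_\lambda(n)$ with $\sum_{k}B^n_{k,\lambda}=1$ such that, for each $k$, $B^n_{k,\lambda}$ vanishes $k$ times at $a$ and $n-k$ times at $b$ (counting multiplicity). Factors: $$\Gamma_\lambda^\eta(n,k)=\frac{S_{\lambda^{(0)}}(a^{n-k},b^k)\,S_\eta(a^{n+2-k},b^k)}{S_\lambda(a^{n+1-k},b^k)\,S_{\eta^{(0)}}(a^{n+1-k},b^k)},\quad \Delta_\lambda^\eta(n,k)=\frac{S_{\lambda^{(0)}}(a^{n-k},b^k)\,S_\eta(a^{n-k},b^{k+2})}{S_\lambda(a^{n-k},b^{k+1})\,S_{\eta^{(0)}}(a^{n-k},b^{k+1})},$$ $$\binom{\eta}{\lambda}_{\!n}=\frac{f_\lambda(n+1)\,f_{\eta^{(0)}}(n+1)}{f_{\lambda^{(0)}}(n)\,f_\eta(n+2)}.$$ *)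

(* Defs.v *)
From HB Require Import structures.
From mathcomp Require Import all_boot all_order perm all_algebra.
From mathcomp Require Import all_classical all_reals all_analysis.
(* The notations of mpoly clash with those of analysis. *)
From mathcomp.multinomials Require mpoly.
Import (canonicals, coercions) mpoly.

Set Implicit Arguments.
Unset Strict Implicit.
Unset Printing Implicit Defensive.
Import Order.TTheory GRing.Theory Num.Theory.
Import numFieldNormedType.Exports.
Local Open Scope classical_set_scope.
Local Open Scope ring_scope.
Local Notation "{ 'mpoly' R [ m ] }" := (mpoly.mpoly m R).

(* Partitions are sequences of naturals, padded with zeros by [nth 0]: the
   part nu_j is [nth 0 nu j.-1], and trailing zeros are irrelevant. *)
Definition is_partition (n : nat) (nu : seq nat) : Prop :=
  sorted geq nu /\ (size nu <= n)%N.

Definition bottom (nu : seq nat) : seq nat := behead nu.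

Section Schur.
Variable R : realType.

(* With 1-based indices, det (X_i ^ (nu_j + m - j)). *)
Definition alternant (m : nat) (nu : seq nat) : {mpoly R[m]} :=
  \det (\matrix_(i < m, j < m)
          (mpoly.mpolyX R (mpoly.mnm1 i) ^+ (nth 0%N nu j + (m - j.+1)))).

(* The quotient of [alternant m nu] by the Vandermonde determinant
   [alternant m [::]], taken in the ring of polynomials, so that it can be
   evaluated at coinciding arguments. It exists and is unique: see
   [schur_alternant] and [schur_uniq]. *)
Definition schur (m : nat) (nu : seq nat) : {mpoly R[m]} :=
  xget 0 [set S | S * alternant m [::] = alternant m nu].

(* S_nu(x^p, y^q) *)
Definition schur2 (nu : seq nat) (p : nat) (x : R) (q : nat) (y : R) : R :=
  mpoly.meval (fun i : 'I_(p + q) => if (i < p)%N then x else y)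
    (schur (p + q) nu).

Definition schur1 (nu : seq nat) (m : nat) : R :=
  mpoly.meval (fun _ : 'I_m => 1) (schur m nu).

End Schur.

(* x_i ^ e = \sum_l c_l x_i ^ l, with c the remainder of 'X^e modulo
   \prod_i ('X - x_i), so every alternant factors through the Vandermonde
   matrix. *)
Lemma det_exp_dvd (A : idomainType) (m : nat) (x : 'I_m -> A)
    (e : 'I_m -> nat) :
  exists S : A, S * \det (\matrix_(i < m, j < m) (x i ^+ (m - j.+1)))
                = \det (\matrix_(i < m, j < m) (x i ^+ e j)).
Proof.
pose d : {poly A} := \prod_(i < m) ('X - (x i)%:P).
have dm : d \is monic by apply: monic_prod => i _; exact: monicXsubC.
have sd : size d = m.+1 by rewrite /d -big_enum size_prod_XsubC size_enum_ord.
have dx i : d.[x i] = 0.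
  by rewrite horner_prod (bigD1 i) //= hornerXsubC subrr mul0r.
pose r j := Pdiv.Ring.rmodp 'X^(e j) d.
have sr j : (size (r j) <= m)%N.
  by rewrite -ltnS -sd Pdiv.Ring.ltn_rmodp monic_neq0.
have rx i j : (r j).[x i] = x i ^+ e j.
  rewrite -[RHS]hornerXn (Pdiv.RingMonic.rdivp_eq dm 'X^(e j)).
  by rewrite hornerD hornerM dx mulr0 add0r.
exists (\det (\matrix_(l < m, j < m) (r j)`_(m - l.+1))).
rewrite mulrC -det_mulmx; congr (\det _); apply/matrixP => i j.
rewrite !mxE -rx (horner_coef_wide _ (sr j)) (reindex_inj rev_ord_inj) /=.
apply: eq_bigr => l _; rewrite !mxE mulrC.
by rewrite (congr1 val (rev_ordK l) : (m - (rev_ord l).+1)%N = l).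
Qed.

Lemma alternant_neq0 (R : realType) (m : nat) : alternant R m [::] != 0.
Proof.
apply/eqP => H0.
have: mpoly.meval (fun i : 'I_m => i%:R : R) (alternant R m [::]) = 0.
  by rewrite H0 rmorph0.
pose v := \row_(i < m) (i%:R : R).
rewrite /alternant -det_map_mx -det_tr.
set W := (X in \det X).
have -> : W = row_perm (perm (@rev_ord_inj m)) (Vandermonde m v).
  apply/matrixP => i j; rewrite !mxE permE nth_nil add0n rmorphXn /=.
  by rewrite mpoly.mevalXU.
rewrite row_permE det_mulmx det_perm det_Vandermonde => /eqP.
rewrite mulf_eq0 signr_eq0 /= => /prodf_eq0 [i _] /prodf_eq0 [j ij].
by rewrite !mxE subr_eq0 eqr_nat => /eqP ji; rewrite ji ltnn in ij.
Qed.

Lemma schur_alternant (R : realType) (m : nat) (nu : seq nat) :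
  schur R m nu * alternant R m [::] = alternant R m nu.
Proof.
rewrite /schur.
apply: (@xgetPex _ 0 [set S | S * alternant R m [::] = alternant R m nu]).
have [S HS] := det_exp_dvd
  (fun i : 'I_m => mpoly.mpolyX R (mpoly.mnm1 i))
  (fun j : 'I_m => nth 0%N nu j + (m - j.+1))%N.
exists S; rewrite /= /alternant -HS; congr (_ * \det _).
by apply/matrixP => i j; rewrite !mxE nth_nil.
Qed.

Lemma schur_uniq (R : realType) (m : nat) (nu : seq nat) (S : {mpoly R[m]}) :
  S * alternant R m [::] = alternant R m nu -> S = schur R m nu.
Proof.
by move=> h; apply: (mulIf (alternant_neq0 R m)); rewrite schur_alternant.
Qed.

Section Muntz.
Variable R : realType.

(* With 1-based indices and lambda_(n+1) = 0, the exponents are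
   lambda_1 - lambda_(i+1) + i for i = 0, ..., n; the natural subtraction does
   not truncate for a partition. *)
Definition muntz_exp (lam : seq nat) (i : nat) : nat :=
  (nth 0%N lam 0 - nth 0%N lam i + i)%N.

(* Functions on ]0, +oo[ are total functions whose values at t <= 0 are
   ignored. *)
Definition muntz (n : nat) (lam : seq nat) (f : R -> R) : Prop :=
  exists c : 'I_n.+1 -> R,
    forall t, 0 < t -> f t = \sum_(i < n.+1) c i * t ^+ muntz_exp lam i.

Definition muntz_map (n : nat) (lam : seq nat) (m : nat)
    (P : R -> 'rV[R]_m) : Prop :=
  forall j : 'I_m, muntz n lam (fun t => P t 0 j).

Definition dim_elevation (n : nat) (lam eta : seq nat) : Prop :=
  is_partition n.+1 eta /\ forall f, muntz n lam f -> muntz n.+1 eta f.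

Definition muntz_basis (n : nat) (lam : seq nat) (B : 'I_n.+1 -> R -> R) :
    Prop :=
  (forall k, muntz n lam (B k)) /\
  (forall f, muntz n lam f ->
     exists! c : 'rV[R]_n.+1,
       forall t, 0 < t -> f t = \sum_(k < n.+1) c 0 k * B k t).

(* At least k times, counting multiplicity. *)
Definition vanishes (k : nat) (f : R -> R) (x : R) : Prop :=
  forall j, (j < k)%N -> derive1n j f x = 0.

Definition chebyshev_bernstein (n : nat) (lam : seq nat) (a b : R)
    (B : 'I_n.+1 -> R -> R) : Prop :=
  [/\ muntz_basis lam B,
      forall t, 0 < t -> \sum_(k < n.+1) B k t = 1
    & forall k : 'I_n.+1, vanishes k (B k) a /\ vanishes (n - k) (B k) b].

End Muntz.

Section Factors.
Variable R : realType.
Variables (lam eta : seq nat) (a b : R) (n : nat).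

Definition Gamma (k : nat) : R :=
  (schur2 (bottom lam) (n - k) a k b * schur2 eta (n + 2 - k) a k b) /
  (schur2 lam (n + 1 - k) a k b * schur2 (bottom eta) (n + 1 - k) a k b).

Definition Delta (k : nat) : R :=
  (schur2 (bottom lam) (n - k) a k b * schur2 eta (n - k) a (k + 2) b) /
  (schur2 lam (n - k) a (k + 1) b * schur2 (bottom eta) (n - k) a (k + 1) b).

Definition part_binom : R :=
  (schur1 R lam (n + 1) * schur1 R (bottom eta) (n + 1)) /
  (schur1 R (bottom lam) n * schur1 R eta (n + 2)).

(* The exponent lambda_1 - eta_1 is an integer, possibly negative. *)
Definition xi (k : nat) : R :=
  (n + 1 - k)%:R * a ^ ((nth 0%N lam 0)%:Z - (nth 0%N eta 0)%:Z) / (n + 1)%:R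
  * part_binom * Gamma k.

Definition rho (k : nat) : R :=
  (k + 1)%:R * b ^ ((nth 0%N lam 0)%:Z - (nth 0%N eta 0)%:Z) / (n + 1)%:R
  * part_binom * Delta k.

End Factors.

(* Main.v *)
Require Import Defs.
From mathcomp Require Import all_boot all_order all_algebra.
From mathcomp Require Import all_classical all_reals all_analysis.
From mathcomp Require Import ring zify.
From mathcomp.multinomials Require mpoly.
Import (canonicals, coercions) mpoly.
Import Order.TTheory GRing.Theory Num.Theory.
Import numFieldNormedType.Exports.
Local Open Scope classical_set_scope.
Local Open Scope ring_scope.

Set Implicit Arguments.
Unset Strict Implicit.
Unset Printing Implicit Defensive.

(** Functions of a Muntz space are polynomials with prescribed exponents, so
    the Chebyshev-Bernstein functions are polynomials
      [B_k = (X - a)^k (X - b)^(n - k) h_k],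
    and everything reduces to the values [h_k(a)] and [h_k(b)] of the
    cofactors ([cofactor_left], [cofactor_right]).

    Since [B_k] lies in E_eta(n+1) and vanishes [k] times at [a] and [n - k]
    times at [b], subtracting suitable multiples of [B'_k] and [B'_(k+1)]
    gives a function of E_eta(n+1) with [n + 2] zeros; a polynomial with [N]
    exponents and [N] positive zeros is zero (Descartes' rule,
    [sparse_dvd_eq0]). So [B_k = al_k B'_k + be_k B'_(k+1)] with
      [al_k = h_k(a) / ((a - b) h'_k(a))],
      [be_k = h_k(b) / ((b - a) h'_(k+1)(b))]
    ([node_poly_elevation]), and the coefficients of [P] follow by uniqueness
    of the expansion in the basis [B'].

    The cofactors are computed by alternating between two relations. With
    [L = lambda_1], [sig_k = S_lambda(a^(n+1-k), b^k)] and
    [gam_k = S_(lambda^(0))(a^(n-k), b^k)]: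
    - [h_k(a) b^L sig_k = h_k(b) a^L sig_(k+1)] ([cofactor_ratio]), because
      [h_k(t)] is, up to a power of [t] and a constant, a Schur polynomial in
      [1/t] and the reciprocals of the other nodes ([schur2_ratio],
      [endpoint_ratio]);
    - [(k+1) h_(k+1)(a) b^L gam_k = - (n-k) h_k(b) a^L gam_(k+1)]
      ([cofactor_step]), the same relation for the derivative of
      [B_(k+1) + ... + B_n = 1 - (B_0 + ... + B_k)], which has [k] zeros at
      [a], [n - k - 1] zeros at [b] and the exponents attached to the bottom
      partition.
    Starting from [(a - b)^n h_0(a) = 1], the product telescopes; the remaining
    quotient [sig_0 / gam_0] has all arguments equal to [a] and gives the
    numbers [f_lambda(n+1) / f_(lambda^(0))(n)] by homogeneity.

    A Schur polynomial at coinciding arguments [v_i] is handled as the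
    determinant of the coefficients of the remainders of the monomials
    [X^(nu_j + m - j)] modulo the product of the [X - v_i] ([meval_schur]);
    Descartes' rule says that it does not vanish at positive arguments. *)

(** * Sparse polynomials and Descartes' rule of signs *)
Definition sparse (R : nzSemiRingType) (E : seq nat) (p : {poly R}) : Prop :=
  forall j, j \notin E -> p`_j = 0.

Section Sparse.
Variable R : fieldType.
Implicit Types (p q : {poly R}) (E : seq nat).

Lemma sparse0 E : sparse E (0 : {poly R}).
Proof. by move=> j _; rewrite coef0. Qed.

Lemma sparseD E p q : sparse E p -> sparse E q -> sparse E (p + q).
Proof. by move=> hp hq j jE; rewrite coefD hp // hq // addr0. Qed.

Lemma sparseZ E c p : sparse E p -> sparse E (c *: p).
Proof. by move=> hp j jE; rewrite coefZ hp // mulr0. Qed.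

Lemma sparse_sum E (I : Type) (r : seq I) (P : pred I) (F : I -> {poly R}) :
  (forall i, P i -> sparse E (F i)) -> sparse E (\sum_(i <- r | P i) F i).
Proof.
move=> hF; elim/big_rec: _ => [|i p Pi hp]; first exact: sparse0.
exact: sparseD (hF i Pi) hp.
Qed.

Lemma sparseXn E e : e \in E -> sparse E ('X^e : {poly R}).
Proof. by move=> eE j; rewrite coefXn; case: eqP => // ->; rewrite eE. Qed.

Lemma sparse_deriv E E' p :
  (forall j, j \in E -> j = 0%N \/ j.-1 \in E') ->
  sparse E p -> sparse E' p^`().
Proof.
move=> hE hp j jE'; rewrite coef_deriv hp ?mul0rn //.
by apply/negP => /hE [] //= jE; rewrite jE in jE'.
Qed.

Lemma sparse_mkseqE (e : nat -> nat) m p :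
  {in gtn m &, injective e} -> sparse (mkseq e m) p ->
  p = \sum_(j < m) p`_(e j) *: 'X^(e j).
Proof.
move=> inj_e hp; apply/polyP => i; rewrite coef_sum.
have [|iE] := boolP (i \in mkseq e m); last first.
  rewrite (hp _ iE) big1 // => j _; rewrite coefZ coefXn.
  case: eqP => [ij|]; last by rewrite mulr0.
  by case/negP: iE; rewrite ij; apply: map_f; rewrite mem_iota /=.
case/mapP => k; rewrite mem_iota add0n => /andP[_ km] ->.
rewrite (bigD1 (Ordinal km)) //= coefZ coefXn eqxx mulr1 big1 ?addr0 //.
move=> j jk; rewrite coefZ coefXn; case: eqP => [/inj_e|]; last by rewrite mulr0.
by rewrite !inE => /(_ km (ltn_ord j)) kj; case/eqP: jk; apply: val_inj.
Qed.

End Sparse.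

Section Descartes.
Variable R : realFieldType.
Implicit Types (p : {poly R}) (E : seq nat).

(** A lower bound on the number of sign variations, witnessed by indices; in
    this form it can be followed through a multiplication by [X - c]. *)
Fixpoint alternates k (s : R) lo p : Prop :=
  if k is k'.+1 then
    exists2 i, (lo <= i)%N & 0 < s * p`_i /\ alternates k' (- s) i.+1 p
  else True.

Lemma alternatesW k s lo lo' p :
  (lo' <= lo)%N -> alternates k s lo p -> alternates k s lo' p.
Proof.
by case: k => //= k ll [i li h]; exists i => //; exact: leq_trans ll li.
Qed.

Lemma alternates_count k s lo p E :
  sparse E p -> alternates k s lo p -> (k <= count (leq lo) E)%N.
Proof.
move=> hp; elim: k s lo => //= k IH s lo [i li [si /IH kE]].
have iE : i \in E.
  by apply/negPn/negP => /hp pi0; rewrite pi0 mulr0 ltxx in si.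
have /permP pE := perm_to_rem iE.
move: kE; rewrite !pE /= li ltnn add0n add1n ltnS => kE.
by apply: (leq_trans kE); apply: sub_count => j /=; lia.
Qed.

Lemma sum_gt0_ex (u : nat -> R) lo hi :
  0 < \sum_(lo <= i < hi) u i ->
  exists2 i, (lo <= i < hi)%N & 0 < u i.
Proof.
move=> h; apply: contrapT => H; move: h; apply/negP; rewrite -leNgt.
rewrite big_nat_cond sumr_le0 // => i /andP[lih _].
by rewrite leNgt; apply/negP => ui; apply: H; exists i.
Qed.

(** The coefficients of [p * (X - c)], weighted by the powers of [c], are the
    differences of the sequence [P]. Hence a coefficient of the appropriate
    sign occurs between two consecutive alternating terms of [P], one more
    before the first term (as [P] starts at zero), and one after the last
    (as [P] ends with zero). The hypothesis on [s * P lo] carries the sign of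
    the previous term through the induction. *)
Lemma alternates_mul_XsubC c p k s lo (P := fun j => c ^+ j * (p * 'X)`_j) :
  0 < c -> s * P lo < 0 \/ (0 < k)%N /\ s * P lo <= 0 ->
  alternates k s lo p -> alternates k.+1 (- s) lo (p * ('X - c%:P)).
Proof.
move=> c0.
have step t l h : (l <= h)%N -> t * P l < t * P h ->
    exists2 i, (l <= i < h)%N & 0 < - t * (p * ('X - c%:P))`_i.
  move=> lh tP.
  have : 0 < \sum_(l <= i < h) t * (P i.+1 - P i).
    by rewrite -mulr_sumr telescope_sumr // mulrBr subr_gt0.
  case/sum_gt0_ex => i lih ti; exists i => //.
  rewrite -(pmulr_rgt0 _ (exprn_gt0 i c0)).
  suff <- : t * (P i.+1 - P i) = c ^+ i * (- t * (p * ('X - c%:P))`_i) by [].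
  rewrite /P [p * (_ - _)]mulrBr coefB -[p * c%:P]mulrC coefCM [(p * 'X)`_i.+1]coefMX /=.
  rewrite exprS; ring.
elim: k s lo => [|k IH] s lo.
  case=> [sP _|[]//]; pose h := maxn lo (size p).+1.
  have Ph : P h = 0.
    rewrite /P nth_default ?mulr0 // (leq_trans (size_polyMleq _ _)) //.
    by rewrite size_polyX /h; lia.
  have [||i /andP[li _] si] := step s lo h; first exact: leq_maxl.
    by rewrite Ph mulr0.
  by exists i.
move=> sP [i li [si alt]].
have Pi : P i.+1 = c ^+ i.+1 * p`_i by rewrite /P coefMX.
have sPi : 0 < s * P i.+1 by rewrite Pi mulrCA pmulr_rgt0 // exprn_gt0.
have [||j /andP[lj ji] sj] := step s lo i.+1; first exact: leqW.
  by apply: le_lt_trans sPi; case: sP => [/ltW|[]].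
exists j => //; split=> //; apply: (@alternatesW _ _ i.+1) => //.
by apply: IH => //; left; rewrite mulNr oppr_lt0.
Qed.

(** Each factor [X - x] adds one alternation, so a nonzero multiple of [m] of
    them has at least [m + 1] nonzero coefficients. *)
Lemma sparse_dvd_eq0 E (s : seq R) p :
  (size E <= size s)%N -> all (fun x => 0 < x) s -> sparse E p ->
  \prod_(x <- s) ('X - x%:P) %| p -> p = 0.
Proof.
move=> Es s0 hp /dvdpP [h hE]; apply/eqP; apply: contraT => p0.
have h0 : h != 0 by apply: contraNneq p0 => h0; rewrite hE h0 mul0r.
suff [t alt] : exists t, alternates (size s).+1 t 0 p.
  have := leq_trans (alternates_count hp alt) (count_size _ _).
  by rewrite ltnNge Es.
rewrite hE {E Es hp hE p0 p}; elim: s s0 => [_|c s IH /= /andP[c0 /IH [t alt]]].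
  rewrite big_nil mulr1; exists (lead_coef h), (size h).-1 => //; split => //.
  by rewrite -expr2 exprn_even_gt0 // lead_coef_eq0.
exists (- t); rewrite big_cons mulrCA [_ * (h * _)]mulrC /=.
apply: alternates_mul_XsubC alt => //.
by right; split=> //; rewrite expr0 mul1r coefMX mulr0.
Qed.

End Descartes.

(** * Schur polynomials as determinants of remainders *)
Definition schur_exp (nu : seq nat) (m j : nat) : nat :=
  (nth 0 nu j + (m - j.+1))%N.

(** The coordinates are listed by decreasing degree, as in the Vandermonde
    matrix [x_i ^ (m - j.+1)], which makes the determinant of the staircase
    exponents equal to [1]. *)
Definition remdet (A : nzRingType) (m : nat) (e : nat -> nat) (d : {poly A}) :=
  \det (\matrix_(l < m, j < m) (Pdiv.Ring.rmodp 'X^(e j) d)`_(m - l.+1)).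

Section RemainderDeterminant.

Lemma map_rmodp (A A' : nzRingType) (f : {rmorphism A -> A'}) (p d : {poly A}) :
  d \is monic ->
  map_poly f (Pdiv.Ring.rmodp p d)
  = Pdiv.Ring.rmodp (map_poly f p) (map_poly f d).
Proof.
move=> dm; have dfm : map_poly f d \is monic by exact: monic_map.
rewrite {2}(Pdiv.RingMonic.rdivp_eq dm p) rmorphD rmorphM /=.
rewrite Pdiv.RingMonic.rmodp_addl_mul_small //.
have -> : size (map_poly f d) = size d.
  by apply: size_map_poly_id0; rewrite (eqP dm) rmorph1 oner_neq0.
apply: leq_ltn_trans (size_poly _ _) _.
by rewrite Pdiv.Ring.ltn_rmodp monic_neq0.
Qed.

Lemma remdet_map (A A' : comNzRingType) (f : {rmorphism A -> A'}) m e
    (d : {poly A}) :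
  d \is monic -> f (remdet m e d) = remdet m e (map_poly f d).
Proof.
move=> dm; rewrite /remdet -det_map_mx; congr (\det _); apply/matrixP => l j.
by rewrite !mxE -coef_map map_rmodp // map_polyXn.
Qed.

Lemma monic_prod_nodes (A : nzRingType) m (x : 'I_m -> A) :
  \prod_(i < m) ('X - (x i)%:P) \is monic.
Proof. by apply: monic_prod => i _; exact: monicXsubC. Qed.

(** A monomial and its remainder take the same values at the nodes, and the
    remainder is a combination of [1, ..., X^(m-1)]. *)
Lemma remdet_vandermonde (A : idomainType) m (x : 'I_m -> A) (e : nat -> nat) :
  remdet m e (\prod_(i < m) ('X - (x i)%:P))
  * \det (\matrix_(i < m, j < m) x i ^+ (m - j.+1))
  = \det (\matrix_(i < m, j < m) x i ^+ e j).
Proof.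
set d := \prod_(i < m) _.
have dm : d \is monic := monic_prod_nodes x.
rewrite mulrC -det_mulmx; congr (\det _); apply/matrixP => i j; rewrite !mxE.
have sr : (size (Pdiv.Ring.rmodp 'X^(e j) d) <= m)%N.
  rewrite -ltnS; have <- : size d = m.+1.
    by rewrite /d -big_enum size_prod_XsubC size_enum_ord.
  by rewrite Pdiv.Ring.ltn_rmodp monic_neq0.
have -> : x i ^+ e j = (Pdiv.Ring.rmodp 'X^(e j) d).[x i].
  rewrite -[LHS]hornerXn {1}(Pdiv.RingMonic.rdivp_eq dm 'X^(e j)).
  rewrite hornerD hornerM horner_prod (bigD1 i) //= hornerXsubC subrr.
  by rewrite mul0r mulr0 add0r.
rewrite (horner_coef_wide _ sr) (reindex_inj rev_ord_inj) /=.
apply: eq_bigr => l _; rewrite !mxE mulrC.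
by rewrite /= subnS (subKn (ltn_ord l)).
Qed.

Variable R : realType.

(** Euclidean division by a monic polynomial commutes with ring morphisms, so
    the identity [remdet_vandermonde], which characterizes the Schur polynomial
    for indeterminate nodes, can be specialized to any nodes, even equal ones. *)
Lemma meval_schur m nu (v : 'I_m -> R) :
  mpoly.meval v (schur R m nu)
  = remdet m (schur_exp nu m) (\prod_(i < m) ('X - (v i)%:P)).
Proof.
pose x i : mpoly.mpoly m R := mpoly.mpolyX R (mpoly.mnm1 i).
have <- : remdet m (schur_exp nu m) (\prod_(i < m) ('X - (x i)%:P))
          = schur R m nu.
  apply: schur_uniq; rewrite -[RHS](remdet_vandermonde x (schur_exp nu m)).
  by congr (_ * \det _); apply/matrixP => i j; rewrite !mxE nth_nil add0n.
rewrite remdet_map; last exact: monic_prod_nodes.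
congr (remdet _ _ _); rewrite rmorph_prod; apply: eq_bigr => i _ /=.
by rewrite rmorphB /= map_polyX map_polyC /= /x mpoly.mevalXU.
Qed.

Lemma schur2_remdet nu p x q y :
  schur2 nu p x q y
  = remdet (p + q) (schur_exp nu (p + q))
      (('X - x%:P) ^+ p * ('X - y%:P) ^+ q) :> R.
Proof.
rewrite /schur2 meval_schur; congr (remdet _ _ _); rewrite big_split_ord /=.
rewrite (eq_bigr (fun=> 'X - x%:P)) => [|i _]; last by rewrite ltn_ord.
rewrite [X in _ * X](eq_bigr (fun=> 'X - y%:P)) => [|i _]; last first.
  by rewrite ltnNge leq_addr.
by rewrite !prodr_const !card_ord.
Qed.

Lemma schur1_remdet nu m :
  schur1 R nu m = remdet m (schur_exp nu m) (('X - 1%:P) ^+ m).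
Proof.
by rewrite /schur1 meval_schur prodr_const card_ord.
Qed.

End RemainderDeterminant.

(** Let [q_j] and [s_j] be the quotient and the remainder of [X^(e j)] by [g].
    The remainder of [X^(e j)] modulo [g * (X - t)] is [q_j(t) g + s_j], so the
    matrix defining [remdet] at [g * (X - t)] is, up to a unitriangular factor
    [U], a matrix [N t] whose first row is [q_j(t)] and whose other rows do not
    depend on [t]. The coefficients [c] of [g * h] satisfy
    [N t *m c = (h(t), 0, ..., 0)], and Cramer's rule reads
    [det (N t) * c_j = h(t) * C_j] with a cofactor [C_j] along the first row,
    which does not depend on [t] either. *)
Lemma remdet_ratio (K : fieldType) n (e : nat -> nat) (g h : {poly K}) x y :
  g \is monic -> size g = n.+1 -> {in gtn n.+1 &, injective e} ->
  sparse (mkseq e n.+1) (g * h) ->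
  h.[x] * remdet n.+1 e (g * ('X - y%:P))
  = h.[y] * remdet n.+1 e (g * ('X - x%:P)).
Proof.
move=> gm sg inj_e hF; have [-> | h0] := eqVneq h 0.
  by rewrite !horner0 !mul0r.
pose q j := Pdiv.Ring.rdivp 'X^(e j) g; pose s j := Pdiv.Ring.rmodp 'X^(e j) g.
pose c j := (g * h)`_(e j).
have FE : g * h = \sum_(j < n.+1) c j *: 'X^(e j) := sparse_mkseqE inj_e hF.
have ss j : (size (s j) <= n)%N.
  by rewrite -ltnS -sg Pdiv.Ring.ltn_rmodp monic_neq0.
have sum_s : \sum_(j < n.+1) c j *: s j = 0.
  rewrite -[RHS](Pdiv.RingMonic.rmodp_mull gm h) [h * g]mulrC FE.
  rewrite Pdiv.RingMonic.rmodp_sum //.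
  by apply: eq_bigr => j _; rewrite Pdiv.RingMonic.rmodpZ.
have sum_q : \sum_(j < n.+1) c j *: q j = h.
  apply: (mulfI (monic_neq0 gm)); rewrite FE mulr_sumr.
  rewrite -[LHS]addr0 -[X in _ + X = _]sum_s -big_split /=; apply: eq_bigr => j _.
  rewrite [in RHS](Pdiv.RingMonic.rdivp_eq gm 'X^(e j)) scalerDr.
  by rewrite -scalerAr [g * _]mulrC.
pose N t : 'M[K]_n.+1 :=
  \matrix_(l, j) if l == ord0 then (q j).[t] else (s j)`_(n.+1 - l.+1).
pose U : 'M[K]_n.+1 :=
  \matrix_(l, k) if k == ord0 then g`_(n.+1 - l.+1) else (l == k)%:R.
have detU : \det U = 1.
  rewrite det_trig; last first.
    apply/is_trig_mxP => i j ij; rewrite mxE.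
    case: eqP ij => [->|_ ij]; first by rewrite ltn0.
    by case: eqP ij => // ->; rewrite ltnn.
  rewrite big1 // => i _; rewrite mxE eqxx; case: eqP => // ->.
  by rewrite subn1 /=; have /eqP := gm; rewrite /lead_coef sg.
have detN t : remdet n.+1 e (g * ('X - t%:P)) = \det (N t).
  rewrite -[RHS]mul1r -detU -det_mulmx; congr (\det _).
  apply/matrixP => l j; rewrite !mxE.
  have gtm : g * ('X - t%:P) \is monic by rewrite monicMr ?monicXsubC.
  have -> : Pdiv.Ring.rmodp 'X^(e j) (g * ('X - t%:P)) = (q j).[t] *: g + s j.
    have /factor_theorem [q2 q2E] : root (q j - (q j).[t]%:P) t.
      by rewrite rootE !hornerE subrr.
    rewrite (Pdiv.RingMonic.rdivp_eq gm 'X^(e j)) -/(q j) -/(s j).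
    rewrite -[in LHS](subrK (q j).[t]%:P (q j)) q2E mulrDl mul_polyC -addrA.
    rewrite -mulrA [('X - _) * g]mulrC.
    rewrite Pdiv.RingMonic.rmodp_addl_mul_small //.
    rewrite size_Mmonic ?monicXsubC ?monic_neq0 // size_XsubC addn2 /=.
    rewrite sg ltnS (leq_trans (size_polyD _ _)) // geq_max.
    by rewrite (leq_trans (size_scale_leq _ _)) ?sg // ltnW // ltnS.
  rewrite big_ord_recl !mxE /= coefD coefZ mulrC; congr (_ + _).
  have [-> | l0] := eqVneq l ord0.
    rewrite subn1 nth_default ?ss // big1 // => k _.
    by rewrite !mxE eq_sym /= mul0r.
  have [k -> _] : {k | l = lift ord0 k & unlift ord0 l = Some k}.
    by apply: unlift_some; rewrite eq_sym.
  rewrite (bigD1 k) //= !mxE /= eqxx mul1r big1 ?addr0 // => i ik.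
  by rewrite !mxE /= eq_sym (inj_eq lift_inj) (negPf ik) mul0r.
have Nc t : N t *m (\col_j c j) = h.[t] *: delta_mx ord0 ord0.
  apply/matrixP => l z; rewrite !mxE ord1 eqxx andbT.
  under eq_bigr do rewrite !mxE mulrC.
  case: eqP => _.
    by rewrite mulr1 -sum_q horner_sum; apply: eq_bigr => j _; rewrite hornerZ.
  transitivity (\sum_(j < n.+1) c j *: s j)`_(n.+1 - l.+1); last first.
    by rewrite sum_s coef0 mulr0.
  by rewrite coef_sum; apply: eq_bigr => j _; rewrite coefZ.
have cramer (j : 'I_n.+1) t : \det (N t) * c j = cofactor (N t) ord0 j * h.[t].
  have /matrixP/(_ j ord0) : \adj (N t) *m (N t *m \col_j c j)
    = \det (N t) *: \col_j c j by rewrite mulmxA mul_adj_mx mul_scalar_mx.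
  rewrite Nc -scalemxAr !mxE (bigD1 ord0) //= !mxE !eqxx mulr1.
  rewrite big1 ?addr0 => [<-|i i0]; first by rewrite mulrC.
  by rewrite !mxE (negPf i0) mulr0.
have cofE (j : 'I_n.+1) : cofactor (N x) ord0 j = cofactor (N y) ord0 j.
  by congr (_ * \det _); apply/matrixP => l k; rewrite !mxE.
have [j cj] : exists j : 'I_n.+1, c j != 0.
  apply: contrapT => H; have : g * h = 0; last first.
    by apply/eqP; rewrite mulf_neq0 // monic_neq0.
  rewrite FE big1 // => j _; case: (eqVneq (c j) 0) => [->|cj].
    by rewrite scale0r.
  by case: H; exists j.
apply: (mulIf cj); rewrite !detN -!mulrA !cramer cofE; ring.
Qed.

(** * Values of Schur polynomials at two nodes *)
Lemma nth_partition nu j k :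
  sorted geq nu -> (j <= k)%N -> (nth 0 nu k <= nth 0 nu j)%N.
Proof.
move=> nus jk; have [ks|/(nth_default 0%N) ->//] := ltnP k (size nu).
have geq_trans : transitive geq by move=> x y z yx xz; exact: leq_trans xz yx.
apply: (sorted_leq_nth geq_trans _ 0%N nus) => //; first exact: leqnn.
by rewrite inE (leq_ltn_trans jk).
Qed.

Lemma behead_sorted nu : sorted geq nu -> sorted geq (behead nu).
Proof. by case: nu => //= x s /path_sorted. Qed.

Lemma schur_exp_inj nu m :
  sorted geq nu -> {in gtn m &, injective (schur_exp nu m)}.
Proof.
move=> nus.
have lt_e j k : (j < k < m)%N -> (schur_exp nu m k < schur_exp nu m j)%N.
  case/andP=> jk km; rewrite /schur_exp -addnS leq_add //; last lia.
  exact: nth_partition (ltnW jk).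
move=> j k; rewrite !inE => jm km ejk.
by case: (ltngtP j k) => // jk; [have := @lt_e j k | have := @lt_e k j];
  rewrite jk ejk ltnn ?jm ?km => /(_ isT).
Qed.

Section SchurValues.
Variable R : realType.
Implicit Types (nu : seq nat) (x y c : R).

Lemma prod_nseq_cat p x q y :
  \prod_(z <- nseq p x ++ nseq q y) ('X - z%:P)
  = ('X - x%:P) ^+ p * ('X - y%:P) ^+ q.
Proof. by rewrite big_cat /= !big_nseq -!Monoid.iteropE. Qed.

Lemma sparse_two_nodes_eq0 E p x q y (F : {poly R}) :
  0 < x -> 0 < y -> (size E <= p + q)%N -> sparse E F ->
  ('X - x%:P) ^+ p * ('X - y%:P) ^+ q %| F -> F = 0.
Proof.
move=> x0 y0 sE hF; rewrite -prod_nseq_cat; apply: sparse_dvd_eq0 hF.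
  by rewrite size_cat !size_nseq.
by rewrite all_cat !all_nseq x0 y0 !orbT.
Qed.

(** A linear relation between the remainders would be a nonzero polynomial with
    [p + q] exponents and [p + q] positive zeros. *)
Lemma schur2_neq0 nu p x q y :
  sorted geq nu -> 0 < x -> 0 < y -> schur2 nu p x q y != 0.
Proof.
move=> nus x0 y0; rewrite schur2_remdet; set m := (p + q)%N.
set e := schur_exp nu m; set d := _ * _.
have dm : d \is monic by rewrite monicMl monic_exp ?monicXsubC.
have sd : size d = m.+1.
  by rewrite /d -prod_nseq_cat size_prod_XsubC size_cat !size_nseq.
rewrite /remdet -det_tr; apply/det0P => -[v v0 vM].
pose F := \sum_(j < m) v 0 j *: 'X^(e j) : {poly R}.
have F0 : F = 0.
  apply: (@sparse_two_nodes_eq0 (mkseq e m) p x q y) => //.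
  - by rewrite size_mkseq.
  - apply: sparse_sum => j _; apply/sparseZ/sparseXn/map_f.
    by rewrite mem_iota /= add0n.
  rewrite Pdiv.Idomain.dvdpE; apply/Pdiv.Ring.rmodp_eq0P; rewrite -/d.
  apply/polyP => i; rewrite coef0.
  have [mi|im] := leqP m i.
    apply: nth_default; apply: leq_trans mi; rewrite -ltnS -sd.
    by rewrite Pdiv.Ring.ltn_rmodp monic_neq0.
  have lm : (m - i.+1 < m)%N by lia.
  have /matrixP/(_ 0 (Ordinal lm)) := vM.
  rewrite !mxE => vl; rewrite Pdiv.RingMonic.rmodp_sum // coef_sum -[RHS]vl.
  apply: eq_bigr => j _; rewrite Pdiv.RingMonic.rmodpZ // coefZ !mxE /=.
  by congr (_ * _`_ _); lia.
case/eqP: v0; apply/rowP => j; rewrite mxE.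
have : F`_(e j) = 0 by rewrite F0 coef0.
rewrite coef_sum (bigD1 j) //= coefZ coefXn eqxx mulr1 big1 ?addr0 //.
move=> k kj; rewrite coefZ coefXn; case: eqP => [/schur_exp_inj|]; last first.
  by rewrite mulr0.
rewrite !inE => /(_ nus (ltn_ord j) (ltn_ord k)) jk.
by case/eqP: kj; apply: val_inj.
Qed.

(** The substitution [X := c X] relates the remainders modulo [(X - c)^m] and
    modulo [(X - 1)^m]; on the determinants it multiplies the columns by the
    powers [c ^ e_j] and divides the rows by the powers of [c]. *)
Lemma schur2_scale nu m c y : c != 0 ->
  schur2 nu m c 0 y = c ^+ (\sum_(j < m) nth 0 nu j) * schur1 R nu m.
Proof.
move=> c0; rewrite schur2_remdet addn0 expr0 mulr1 schur1_remdet /remdet.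
pose r z j := Pdiv.Ring.rmodp 'X^(schur_exp nu m j) (('X - z%:P) ^+ m : {poly R}).
have rE i j : c ^+ i * (r c j)`_i = c ^+ schur_exp nu m j * (r 1 j)`_i.
  set e := schur_exp nu m j; pose S := (c *: 'X : {poly R}).
  have dm z : ('X - z%:P) ^+ m \is @monic R by rewrite monic_exp ?monicXsubC.
  have comp_d : ('X - c%:P) ^+ m \Po S = c ^+ m *: ('X - 1%:P) ^+ m.
    rewrite rmorphXn /= comp_polyB comp_polyX comp_polyC -exprZn scalerBr.
    by rewrite -[c *: 1%:P]mul_polyC -polyCM mulr1.
  have -> : c ^+ i * (r c j)`_i = (r c j \Po S)`_i.
    rewrite /S coef_comp_poly.
    have [si|si] := leqP (size (r c j)) i.
      rewrite nth_default // mulr0 big1 // => k _.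
      rewrite exprZn coefZ coefXn; case: eqP => [ik|]; last by rewrite !mulr0.
      by have := ltn_ord k; rewrite -ik ltnNge si.
    rewrite (bigD1 (Ordinal si)) //= exprZn coefZ coefXn eqxx mulr1 mulrC.
    rewrite big1 ?addr0 // => k ki; rewrite exprZn coefZ coefXn.
    case: eqP => [ik|]; last by rewrite !mulr0.
    by case/eqP: ki; apply: val_inj.
  have := congr1 (comp_poly S) (Pdiv.RingMonic.rdivp_eq (dm c) 'X^e).
  rewrite comp_polyD comp_polyM comp_d comp_Xn_poly /S exprZn.
  rewrite -scalerAr scalerAl => eqX.
  rewrite -coefZ /r -Pdiv.RingMonic.rmodpZ // eqX.
  rewrite Pdiv.RingMonic.rmodp_addl_mul_small //.
  rewrite size_comp_poly2 ?size_scale ?size_polyX //.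
  by rewrite size_exp_XsubC -(size_exp_XsubC m c) Pdiv.Ring.ltn_rmodp monic_neq0.
pose D (u : 'I_m -> R) := diag_mx (\row_i u i).
pose M z : 'M[R]_m := \matrix_(l, j) (r z j)`_(m - l.+1).
have detD u : \det (D u) = \prod_i u i.
  by rewrite det_diag; apply: eq_bigr => i _; rewrite mxE.
have : D (fun l => c ^+ (m - l.+1)) *m M c
       = M 1 *m D (fun j => c ^+ schur_exp nu m j).
  by apply/matrixP => l j; rewrite mul_diag_mx mul_mx_diag !mxE rE mulrC.
move/(congr1 determinant); rewrite !det_mulmx !detD -!expr_sum.
rewrite /schur_exp big_split /= exprD mulrA mulrC => /mulIf -> //.
  by rewrite mulrC.
by rewrite expf_neq0.
Qed.

Lemma schur1_neq0 nu m : sorted geq nu -> schur1 R nu m != 0.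
Proof.
move=> nus; have := schur2_neq0 m 0 nus (@ltr01 R) (@ltr01 R).
by rewrite schur2_scale ?oner_neq0 // expr1n mul1r.
Qed.

(** The cofactor [h] of such a polynomial is proportional to
    [t |-> S_nu(t, x^p, y^q)]; comparing [t = x] with [t = y] avoids naming the
    constant. *)
Lemma schur2_ratio nu p x q y (h : {poly R}) :
  sorted geq nu ->
  sparse (mkseq (schur_exp nu (p + q).+1) (p + q).+1)
    (('X - x%:P) ^+ p * ('X - y%:P) ^+ q * h) ->
  h.[x] * schur2 nu p x q.+1 y = h.[y] * schur2 nu p.+1 x q y.
Proof.
move=> nus hF; set g := _ ^+ p * _ ^+ q in hF.
have gm : g \is monic by rewrite monicMl monic_exp ?monicXsubC.
have sg : size g = (p + q).+1.
  by rewrite /g -prod_nseq_cat size_prod_XsubC size_cat !size_nseq.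
rewrite !schur2_remdet addnS addSn !exprSr mulrA.
rewrite [X in _ = _ * remdet _ _ X]mulrAC -/g.
exact: remdet_ratio gm sg (schur_exp_inj nus) hF.
Qed.

End SchurValues.

(** * Endpoint values in Muntz spaces *)
Section Reciprocal.
Variable R : realType.
Implicit Types (nu : seq nat) (a b c : R) (h F : {poly R}).

Lemma eq_poly_pos (p q : {poly R}) : (forall u, 0 < u -> p.[u] = q.[u]) -> p = q.
Proof.
move=> pq; apply/eqP; rewrite -subr_eq0; apply: contraT => d0.
pose s := mkseq (fun i => i.+1%:R : R) (size (p - q)).
have us : uniq s.
  by rewrite map_inj_uniq ?iota_uniq // => i j /eqP; rewrite eqr_nat => /eqP[].
have rs : all (root (p - q)) s.
  apply/allP => _ /mapP[i _ ->]; by rewrite rootE hornerD hornerN pq ?subrr.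
by have := max_poly_roots d0 rs us; rewrite size_mkseq ltnn.
Qed.

(** This is [u ^ N * F (c / u)]. With [c = a * b] the substitution exchanges the
    nodes [a] and [b], which leaves no inverses in the Schur polynomials. *)
Definition recip_poly (N : nat) c F : {poly R} :=
  \poly_(i < N.+1) (F`_(N - i) * c ^+ (N - i)).

Lemma horner_recip N c F u :
  (size F <= N.+1)%N -> u != 0 -> (recip_poly N c F).[u] = u ^+ N * F.[c / u].
Proof.
move=> sF u0; rewrite horner_poly (horner_coef_wide _ sF) mulr_sumr.
rewrite (reindex_inj rev_ord_inj) /=; apply: eq_bigr => i _.
have iN : (i <= N)%N by rewrite -ltnS.
rewrite subSS (subKn iN) exprMn exprVn.
have -> : u ^+ N = u ^+ (N - i) * u ^+ i by rewrite -exprD subnK.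
by field; rewrite expf_neq0.
Qed.

(** These exponents are those of [schur_exp] subtracted from their common bound
    [M + n]: the reciprocal of a Muntz polynomial has the exponents of an
    alternant ([sparse_recip]). *)
Definition gap_exp (M : nat) nu (j : nat) : nat := (M - nth 0 nu j + j)%N.

Lemma sparse_recip M nu n c F :
  sorted geq nu -> (nth 0 nu 0 <= M)%N ->
  sparse (mkseq (gap_exp M nu) n.+1) F ->
  sparse (mkseq (schur_exp nu n.+1) n.+1) (recip_poly (M + n) c F).
Proof.
move=> nus nuM hF i iE; rewrite coef_poly; case: ltnP => // iN.
rewrite hF ?mul0r //; apply: contraNN iE => /mapP[j].
rewrite mem_iota => /andP[_ jn] ej; apply/mapP; exists j => //.
  by rewrite mem_iota.
have := nth_partition nus (leq0n j); rewrite /schur_exp.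
by move: ej iN jn nuM; rewrite /gap_exp; lia.
Qed.

Lemma size_sparse_gap M nu n F :
  sparse (mkseq (gap_exp M nu) n.+1) F -> (size F <= (M + n).+1)%N.
Proof.
move=> hF; apply/leq_sizeP => j Mj; apply: hF; apply/mapP => -[k].
by rewrite mem_iota /gap_exp => /andP[_ kn]; lia.
Qed.

(** [schur2_ratio] applied to the reciprocal polynomial, whose cofactor is
    proportional to [u ^ M * h (a * b / u)]. *)
Lemma endpoint_ratio M nu p q a b h :
  0 < a -> 0 < b -> sorted geq nu -> (nth 0 nu 0 <= M)%N ->
  sparse (mkseq (gap_exp M nu) (p + q).+1)
    (('X - a%:P) ^+ p * ('X - b%:P) ^+ q * h) ->
  h.[a] * b ^+ M * schur2 nu q.+1 a p b = h.[b] * a ^+ M * schur2 nu q a p.+1 b.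
Proof.
move=> a0 b0 nus nuM; set g := _ ^+ p * _ ^+ q => hF.
have [-> | h0] := eqVneq h 0; first by rewrite !horner0 !mul0r.
have gm : g \is monic by rewrite monicMl monic_exp ?monicXsubC.
have sg : size g = (p + q).+1.
  by rewrite /g -prod_nseq_cat size_prod_XsubC size_cat !size_nseq.
have sh : (size h <= M.+1)%N.
  by have := size_sparse_gap hF; rewrite size_monicM // sg; lia.
have sF : (size (g * h)%R <= (M + (p + q)).+1)%N := size_sparse_gap hF.
have [an0 bn0] : a != 0 /\ b != 0 by rewrite !gt_eqF.
pose H := recip_poly M (a * b) h.
pose k := (-1) ^+ (p + q) * a ^+ p * b ^+ q.
have k0 : k != 0 by rewrite !mulf_neq0 ?expf_neq0 ?oppr_eq0 ?oner_eq0.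
have FE : recip_poly (M + (p + q)) (a * b) (g * h)
          = ('X - a%:P) ^+ q * ('X - b%:P) ^+ p * (k *: H).
  apply: eq_poly_pos => u u0; have un0 : u != 0 by rewrite gt_eqF.
  rewrite horner_recip // /g /H !(hornerM, horner_exp, hornerXsubC, hornerZ).
  rewrite horner_recip // !exprD.
  have pow (x y : R) e : u ^+ e * (x * y / u - x) ^+ e
      = (-1) ^+ e * x ^+ e * (u - y) ^+ e.
    by rewrite -!exprMn; congr (_ ^+ e); field.
  move: (pow a b p) (pow b a q); rewrite [b * a]mulrC /k exprD.
  move: (h.[_]) ((_ / u - a) ^+ p) ((_ / u - b) ^+ q) => v A B eA eB.
  transitivity (u ^+ M * (u ^+ p * A) * (u ^+ q * B) * v).
    by rewrite !mulrA [_ * A * u ^+ q]mulrAC.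
  rewrite eA eB; move: ((u - a) ^+ q) ((u - b) ^+ p) => C D.
  move: ((-1) ^+ p) ((-1) ^+ q) (a ^+ p) (b ^+ q) (u ^+ M) => *; ring.
have := sparse_recip (a * b) nus nuM hF; rewrite FE [(p + q)%N]addnC.
move=> /(schur2_ratio nus); rewrite !hornerZ !horner_recip //.
rewrite [a * b / a]mulrAC divff // mul1r mulfK // -!(mulrA k) => /(mulfI k0) E.
by rewrite [h.[a] * _]mulrC -E [a ^+ M * _]mulrC.
Qed.

End Reciprocal.

(** * Cofactors of the Chebyshev-Bernstein basis *)
Definition muntz_exps lam n : seq nat :=
  mkseq (gap_exp (nth 0 lam 0) lam) n.+1.

Definition node_poly (R : realType) n (a b : R) (h : nat -> {poly R}) k :=
  ('X - a%:P) ^+ k * ('X - b%:P) ^+ (n - k) * h k.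

(** The polynomial form of a Chebyshev-Bernstein basis: the [k]-th function is
    [(X - a)^k (X - b)^(n-k) h_k]. *)
Definition cb_cofactors (R : realType) n lam (a b : R) (h : nat -> {poly R}) :=
  (forall k, (k <= n)%N -> sparse (muntz_exps lam n) (node_poly n a b h k)) /\
  \sum_(0 <= k < n.+1) node_poly n a b h k = 1.

Section Cofactors.
Variable R : realType.
Implicit Types (a b : R) (u : {poly R}) (h : nat -> {poly R}).

Lemma deriv_XsubC_exp_mul a k u :
  exists2 u1, ((('X - a%:P) ^+ k.+1) * u)^`() = ('X - a%:P) ^+ k * u1
    & u1.[a] = k.+1%:R * u.[a].
Proof.
exists (u *+ k.+1 + ('X - a%:P) * u^`()).
  rewrite derivM deriv_exp derivXsubC mul1r exprSr /=; ring.
rewrite !hornerE subrr mul0r addr0 hornerMn mulr_natl //.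
Qed.

Lemma XsubC_exp_gcd a b k r (u v : {poly R}) : a != b ->
  ('X - a%:P) ^+ k * u + ('X - b%:P) ^+ r * v = 0 ->
  exists2 g, u = ('X - b%:P) ^+ r * g & v = - (('X - a%:P) ^+ k * g).
Proof.
move=> ab uv0.
have xn0 c e : ('X - c%:P) ^+ e != 0 :> {poly R}.
  by rewrite expf_neq0 // polyXsubC_eq0.
have : ('X - b%:P) ^+ r %| ('X - a%:P) ^+ k * u.
  by move/eqP: uv0; rewrite addr_eq0 => /eqP ->; rewrite -mulrN dvdp_mulr.
rewrite Gauss_dvdpr; last first.
  by rewrite coprimep_expl ?coprimep_expr ?coprimep_XsubC2 // subr_eq0.
case/dvdpP => g ug; exists g; first by rewrite mulrC.
apply: (mulfI (xn0 b r)); apply/eqP; rewrite mulrN -addr_eq0 -[X in _ == X]uv0 ug.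
by apply/eqP; ring.
Qed.

Lemma sum_split_node n k a b h : (k < n)%N ->
  \sum_(0 <= j < n.+1) node_poly n a b h j
  = ('X - b%:P) ^+ (n - k) *
      (\sum_(0 <= j < k.+1) ('X - a%:P) ^+ j * ('X - b%:P) ^+ (k - j) * h j)
  + ('X - a%:P) ^+ k.+1 *
      (\sum_(k.+1 <= j < n.+1)
         ('X - a%:P) ^+ (j - k.+1) * ('X - b%:P) ^+ (n - j) * h j).
Proof.
move=> kn; rewrite (@big_cat_nat _ _ _ k.+1) //=; last by rewrite ltnS ltnW.
rewrite !mulr_sumr; congr (_ + _).
  apply: eq_big_nat => j /andP[_ jk]; rewrite /node_poly mulrA; congr (_ * _).
  rewrite mulrCA -exprD; congr (_ * _ ^+ _); lia.
apply: eq_big_nat => j /andP[kj jn]; rewrite /node_poly !mulrA -exprD.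
by rewrite subnKC.
Qed.

Lemma horner_left_sum n k a b h : (k < n)%N ->
  (\sum_(k.+1 <= j < n.+1)
     ('X - a%:P) ^+ (j - k.+1) * ('X - b%:P) ^+ (n - j) * h j).[a]
  = (a - b) ^+ (n - k.+1) * (h k.+1).[a].
Proof.
move=> kn; rewrite horner_sum big_ltn; last by [].
rewrite subnn mul1r hornerM horner_exp hornerXsubC big_nat big1 ?addr0 //.
move=> j /andP[kj _]; rewrite !hornerM horner_exp hornerXsubC subrr.
by rewrite expr0n subn_eq0 leqNgt kj !mul0r.
Qed.

Lemma horner_right_sum k a b h :
  (\sum_(0 <= j < k.+1) ('X - a%:P) ^+ j * ('X - b%:P) ^+ (k - j) * h j).[b]
  = (b - a) ^+ k * (h k).[b].
Proof.
rewrite horner_sum big_nat_recr //= subnn mulr1 hornerM horner_exp hornerXsubC.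
rewrite big_nat big1 ?add0r // => j /andP[_ jk].
rewrite !hornerM !horner_exp !hornerXsubC subrr.
by rewrite expr0n subn_eq0 leqNgt jk mulr0 mul0r.
Qed.

Variables (n : nat) (lam : seq nat) (a b : R) (h : nat -> {poly R}).
Hypotheses (a0 : 0 < a) (ab : a < b) (lams : sorted geq lam).
Hypothesis hh : cb_cofactors n lam a b h.

Let L := nth 0%N lam 0.
Let sig k := schur2 lam (n.+1 - k) a k b.
Let gam k := schur2 (behead lam) (n - k) a k b.

Let b0 : 0 < b := lt_trans a0 ab.

Lemma cofactor_ratio k : (k <= n)%N ->
  (h k).[a] * b ^+ L * sig k = (h k).[b] * a ^+ L * sig k.+1.
Proof.
move=> kn; rewrite /sig subSn // subSS; apply: endpoint_ratio => //.
by have := hh.1 _ kn; rewrite /muntz_exps subnKC.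
Qed.

(** The two halves of the partition of unity, [v] up to the index [k] and [u]
    beyond, have opposite derivatives. This common derivative is divisible by
    [(X - a)^k], by the form of [u], and by [(X - b)^(n-k-1)], by the form of
    [v]. Its cofactor [g] takes the values [(k+1) h_(k+1)(a)] and
    [- (n-k) h_k(b)], which [endpoint_ratio] compares. *)
Lemma cofactor_step k : (k < n)%N ->
  k.+1%:R * (h k.+1).[a] * b ^+ L * gam k
  = - ((n - k)%:R * (h k).[b] * a ^+ L * gam k.+1).
Proof.
move=> kn; have anb : a != b by rewrite lt_eqF.
have nk : (n - k = (n - k.+1).+1)%N by rewrite subnSK.
have := hh.2; rewrite (sum_split_node a b h kn).
set v := \sum_(0 <= _ < _) _; set u := \sum_(_ <= _ < _) _ => VW.
have [u1 u1E u1a] := deriv_XsubC_exp_mul a k u.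
have [v1 v1E v1b] := deriv_XsubC_exp_mul b (n - k.+1) v.
have /(XsubC_exp_gcd anb)[g u1g v1g] :
    ('X - a%:P) ^+ k * u1 + ('X - b%:P) ^+ (n - k.+1) * v1 = 0.
  by rewrite -u1E -v1E -nk -derivD addrC VW derivC.
have ga : g.[a] = k.+1%:R * (h k.+1).[a].
  apply: (mulfI (expf_neq0 (n - k.+1) (_ : a - b != 0))).
    by rewrite subr_eq0.
  rewrite mulrCA -(horner_left_sum a b h kn) -/u -u1a u1g.
  by rewrite hornerM horner_exp hornerXsubC.
have gb : g.[b] = - ((n - k)%:R * (h k).[b]).
  apply: (mulfI (expf_neq0 k (_ : b - a != 0))).
    by rewrite subr_eq0 eq_sym.
  rewrite mulrN mulrCA -(horner_right_sum k a b h) -/v nk -v1b v1g hornerN opprK.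
  by rewrite hornerM horner_exp hornerXsubC.
rewrite -ga; transitivity (g.[b] * a ^+ L * gam k.+1); last by rewrite gb !mulNr.
rewrite /gam nk; apply: endpoint_ratio => //.
- exact: behead_sorted.
- by rewrite nth_behead nth_partition.
rewrite -mulrA -u1g -u1E.
have -> : ((k + (n - k.+1)).+1 = n)%N by rewrite -addSn subnKC.
apply: (@sparse_deriv _ (muntz_exps lam n)).
  move=> j /mapP[[|i]]; rewrite mem_iota /gap_exp => /andP[_ jn] ->.
    by left; rewrite subnn.
  right; apply/mapP; exists i; first by rewrite mem_iota.
  by rewrite nth_behead addnS.
have -> : ('X - a%:P) ^+ k.+1 * u = \sum_(k.+1 <= j < n.+1) node_poly n a b h j.
  rewrite mulr_sumr; apply: eq_big_nat => j /andP[kj jn].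
  by rewrite /node_poly !mulrA -exprD subnKC.
by rewrite big_nat; apply: sparse_sum => j /andP[_ jn]; exact: hh.1.
Qed.

Lemma cofactor_first : (a - b) ^+ n * (h 0).[a] = 1.
Proof.
have := congr1 (horner^~ a) hh.2; rewrite hornerC => <-.
rewrite horner_sum big_ltn // big_nat big1 ?addr0.
  by rewrite !hornerM !horner_exp !hornerXsubC expr0 mul1r subn0.
move=> j /andP[j0 _]; rewrite !hornerM !horner_exp !hornerXsubC subrr.
by rewrite expr0n gtn_eqF // !mul0r.
Qed.

Lemma cofactor_last : (b - a) ^+ n * (h n).[b] = 1.
Proof.
have := congr1 (horner^~ b) hh.2; rewrite hornerC => <-.
rewrite horner_sum big_nat_recr //= big_nat big1 ?add0r.
  by rewrite !hornerM !horner_exp !hornerXsubC subnn mulr1.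
move=> j /andP[_ jn]; rewrite !hornerM !horner_exp !hornerXsubC subrr.
by rewrite expr0n subn_eq0 leqNgt jn mulr0 mul0r.
Qed.

Lemma sig_neq0 k : sig k != 0.
Proof. by rewrite schur2_neq0 //. Qed.

Lemma gam_neq0 k : gam k != 0.
Proof. by rewrite schur2_neq0 ?behead_sorted //. Qed.

(** Homogeneity: the degrees of [S_lambda] and of the Schur polynomial of the
    bottom partition differ by [lambda_1]. *)
Lemma sig_gam0 : 
  sig 0 / gam 0 = a ^+ L * (schur1 R lam n.+1 / schur1 R (behead lam) n).
Proof.
rewrite /sig /gam !subn0 !schur2_scale ?gt_eqF //.
rewrite big_ord_recl exprD -/L.
have -> : (\sum_(i < n) nth 0 lam (lift ord0 i)
           = \sum_(j < n) nth 0 (behead lam) j)%N.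
  by apply: eq_bigr => i _; rewrite nth_behead.
have := schur1_neq0 R n (behead_sorted lams).
have an0 : a != 0 by rewrite gt_eqF.
have := expf_neq0 (\sum_(j < n) nth 0 (behead lam) j)%N an0.
by move: (a ^+ L) (a ^+ _) => x y y0 z0; field; rewrite y0 z0.
Qed.

(** [cofactor_ratio] and [cofactor_step] give the quotient of two consecutive
    values; the factors [k+1] and [n-k] produce the binomial coefficient. *)
Lemma cofactor_left k : (k <= n)%N ->
  (h k).[a] = (-1) ^+ k * 'C(n, k)%:R * (a - b) ^- n *
    (a ^+ L * (schur1 R lam n.+1 / schur1 R (behead lam) n)) * (gam k / sig k).
Proof.
rewrite -sig_gam0; elim: k => [_|k IH kn].
  have := cofactor_first; rewrite mulrC => h0.
  have d0 : (a - b) ^+ n != 0 by rewrite expf_neq0 // subr_eq0 lt_eqF.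
  rewrite -[LHS](mulfK d0) h0 expr0 bin0.
  move: d0 (sig_neq0 0) (gam_neq0 0).
  by move: (_ ^+ n) (sig 0) (gam 0) => D s g d s0 g0; field; rewrite d s0 g0.
have := cofactor_step kn; have := cofactor_ratio (ltnW kn).
have /(congr1 (fun i => i%:R : R)) := mul_bin_left n k; rewrite !natrM.
rewrite IH ?(ltnW kn) // exprS mulN1r.
have A0 : a ^+ L != 0 by rewrite expf_neq0 // gt_eqF.
have B0 : b ^+ L != 0 by rewrite expf_neq0 // gt_eqF //.
have K0 : k.+1%:R != 0 :> R by rewrite pnatr_eq0.
(* Powers and Schur values are atoms for [field]. *)
move: A0 B0 K0 (sig_neq0 k) (sig_neq0 k.+1) (gam_neq0 k).
move: ((h k).[b]) ((h k.+1).[a]) (a ^+ L) (b ^+ L) (k.+1%:R) ((n - k)%:R).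
move: (sig k) (sig k.+1) (gam k) (gam k.+1) (sig 0 / gam 0) ((-1) ^+ k).
move: ('C(n, k)%:R) ('C(n, k.+1)%:R) ((a - b) ^- n).
move=> C C' D s s' g g' ka e hb ha' A B K N A0 B0 K0 s0 s'0 g0 EC Er Es.
have -> : ha' = - (N * hb * A * g') / (K * B * g).
  by rewrite -Es; field; rewrite g0 B0 K0.
have -> : hb = e * C * D * ka * (g / s) * B * s / (A * s').
  by rewrite Er; field; rewrite s'0 A0.
have -> : C' = N * C / K by rewrite -EC; field.
by field; rewrite K0 s'0 g0 B0 s0 A0.
Qed.

Lemma cofactor_left_neq0 k : (k <= n)%N ->
  (h k).[a] != 0.
Proof.
move=> kn; rewrite cofactor_left //.
rewrite !(mulf_neq0, invr_neq0, expf_neq0) ?oppr_eq0 ?oner_eq0 //.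
- by rewrite pnatr_eq0 -lt0n bin_gt0.
- by rewrite subr_eq0 lt_eqF.
- by rewrite gt_eqF.
- exact: schur1_neq0.
- exact/schur1_neq0/behead_sorted.
- exact: gam_neq0.
- exact: sig_neq0.
Qed.

Lemma cofactor_right k : (k <= n)%N ->
  (h k).[b] = (-1) ^+ k * 'C(n, k)%:R * (a - b) ^- n *
    (b ^+ L * (schur1 R lam n.+1 / schur1 R (behead lam) n))
    * (gam k / sig k.+1).
Proof.
move=> kn; have := cofactor_ratio kn; rewrite cofactor_left //.
have A0 : a ^+ L != 0 by rewrite expf_neq0 // gt_eqF.
move: A0 (sig_neq0 k) (sig_neq0 k.+1).
move: (a ^+ L) (b ^+ L) (sig k) (sig k.+1) (_ / schur1 R _ _) ((a - b) ^- n).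
move: ((-1) ^+ k) => e A B s s' f D A0 s0 s'0 E.
apply: (mulIf A0); apply: (mulIf s'0); rewrite -E; field; by rewrite s0 s'0.
Qed.

Lemma cofactor_right_neq0 k : (k <= n)%N ->
  (h k).[b] != 0.
Proof.
move=> kn; have := cofactor_ratio kn; apply: contra_eq_neq => ->.
rewrite !mul0r !mulf_neq0 ?cofactor_left_neq0 ?expf_neq0 ?sig_neq0 //.
by rewrite gt_eqF //.
Qed.

End Cofactors.

(** * Dimension elevation *)
Section Elevation.
Variable R : realType.
Variables (n : nat) (lam eta : seq nat) (a b : R) (h h' : nat -> {poly R}).
Hypotheses (a0 : 0 < a) (ab : a < b).
Hypotheses (lams : sorted geq lam) (etas : sorted geq eta).
Hypotheses (hh : cb_cofactors n lam a b h) (hh' : cb_cofactors n.+1 eta a b h').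

(** The factors [n+1-k] and [n+1] of [xi] are those of the quotient
    [C(n, k) / C(n+1, k)]. *)
Lemma cofactor_xi k : (k <= n)%N ->
  (h k).[a] / ((a - b) * (h' k).[a]) = xi lam eta a b n k.
Proof.
move=> kn; have b0 := lt_trans a0 ab.
rewrite (cofactor_left a0 ab lams hh) // (cofactor_left a0 ab etas hh') ?leqW //.
rewrite /xi /Gamma /part_binom /Defs.bottom !addn1 addn2 expfzDr; last first.
  by rewrite gt_eqF.
rewrite -!exprnN -!exprnP !subSn ?leqW // (exprS (a - b)).
have d0 : a - b != 0 by rewrite subr_eq0 lt_eqF.
have an0 : a != 0 by rewrite gt_eqF.
have C0 : 'C(n.+1, k)%:R != 0 :> R by rewrite pnatr_eq0 -lt0n bin_gt0 leqW.
have /(congr1 (fun i => i%:R : R)) := mul_bin_down n.+1 k.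
rewrite !natrM /= subSn // => EC.
have N0 : n.+1%:R != 0 :> R by rewrite pnatr_eq0.
have e0 : (-1) ^+ k != 0 :> R by rewrite expf_neq0 ?oppr_eq0 ?oner_eq0.
move: e0 d0 C0 N0 EC (expf_neq0 n d0) (expf_neq0 (nth 0%N eta 0) an0).
have bls := behead_sorted lams; have bes := behead_sorted etas.
move: (schur1_neq0 R n bls) (schur1_neq0 R n.+2 etas).
move: (schur1_neq0 R n.+1 bes) (schur2_neq0 (n - k).+1 k lams a0 b0).
move: (schur2_neq0 (n - k).+1 k bes a0 b0) (schur2_neq0 (n - k).+2 k etas a0 b0).
move: (schur2 lam _ _ _ _) (schur2 (behead lam) _ _ _ _).
move: (schur2 eta _ _ _ _) (schur2 (behead eta) _ _ _ _).
move: (schur1 R lam _) (schur1 R (behead lam) _).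
move: (schur1 R eta _) (schur1 R (behead eta) _).
move: (_ ^+ k) (a - b) (_ ^+ n) (a ^+ _) (a ^+ _) n.+1%:R 'C(n, _)%:R 'C(_, _)%:R.
move=> e d D A' A N C C' fe fbe fl fbl se sbe sl sbl.
move=> sbe0 se0 fbe0 sl0 fbl0 fe0 e0 d0 C'0 N0 EC D0 A'0.
have -> : C = (n - k).+1%:R * C' / N by rewrite -EC; field.
by field; rewrite ?(sbe0, se0, fbe0, sl0, fbl0, fe0, e0, d0, C'0, N0, D0, A'0).
Qed.

(** The sign [(-1)^(k+1)] of [h'_(k+1)(b)] is compensated by that of [b - a],
    and [C(n, k) / C(n+1, k+1)] is [(k+1) / (n+1)]. *)
Lemma cofactor_rho k : (k <= n)%N ->
  (h k).[b] / ((b - a) * (h' k.+1).[b]) = rho lam eta a b n k.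
Proof.
move=> kn; have b0 := lt_trans a0 ab.
rewrite (cofactor_right a0 ab lams hh) // (cofactor_right a0 ab etas hh') //.
rewrite /rho /Delta /part_binom /Defs.bottom !addn1 !addn2 expfzDr; last first.
  by rewrite gt_eqF.
rewrite -!exprnN -!exprnP !subSS (exprS (a - b)) exprS mulN1r -[b - a]opprB.
have d0 : a - b != 0 by rewrite subr_eq0 lt_eqF.
have bn0 : b != 0 by rewrite gt_eqF.
have C0 : 'C(n.+1, k.+1)%:R != 0 :> R by rewrite pnatr_eq0 -lt0n bin_gt0.
have /(congr1 (fun i => i%:R : R)) := mul_bin_diag n.+1 k.
rewrite !natrM /= => EC.
have N0 : n.+1%:R != 0 :> R by rewrite pnatr_eq0.
have e0 : (-1) ^+ k != 0 :> R by rewrite expf_neq0 ?oppr_eq0 ?oner_eq0.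
move: e0 d0 C0 N0 EC (expf_neq0 n d0) (expf_neq0 (nth 0%N eta 0) bn0).
have bls := behead_sorted lams; have bes := behead_sorted etas.
move: (schur1_neq0 R n bls) (schur1_neq0 R n.+2 etas).
move: (schur1_neq0 R n.+1 bes) (schur2_neq0 (n - k) k.+1 lams a0 b0).
move: (schur2_neq0 (n - k) k.+1 bes a0 b0) (schur2_neq0 (n - k) k.+2 etas a0 b0).
move: (schur2 lam _ _ _ _) (schur2 (behead lam) _ _ _ _).
move: (schur2 eta _ _ _ _) (schur2 (behead eta) _ _ _ _).
move: (schur1 R lam _) (schur1 R (behead lam) _).
move: (schur1 R eta _) (schur1 R (behead eta) _).
move: (_ ^+ k) (a - b) (_ ^+ n) (b ^+ _) (b ^+ _) n.+1%:R 'C(n, _)%:R 'C(_, _)%:R.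
move=> e d D B' B N C C' fe fbe fl fbl se sbe sl sbl.
move=> sbe0 se0 fbe0 sl0 fbl0 fe0 e0 d0 C'0 N0 EC D0 B'0.
have -> : C = k.+1%:R * C' / N by rewrite -EC; field.
by field; rewrite ?(sbe0, se0, fbe0, sl0, fbl0, fe0, e0, d0, C'0, N0, D0, B'0).
Qed.

(** The difference of the two sides is a multiple of [(X - a)^k (X - b)^(n-k)],
    and the coefficients are such that its cofactor [r] also vanishes at [a] and
    at [b]; this makes [n + 2] zeros for [n + 2] exponents. *)
Lemma node_poly_elevation k : (k <= n)%N ->
  sparse (muntz_exps eta n.+1) (node_poly n a b h k) ->
  node_poly n a b h k
  = xi lam eta a b n k *: node_poly n.+1 a b h' k
    + rho lam eta a b n k *: node_poly n.+1 a b h' k.+1.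
Proof.
move=> kn hk; have b0 := lt_trans a0 ab.
have d0 : a - b != 0 by rewrite subr_eq0 lt_eqF.
have d0' : b - a != 0 by rewrite -opprB oppr_eq0.
have ha0 := cofactor_left_neq0 a0 ab etas hh' (leqW kn).
have hb0 := cofactor_right_neq0 a0 ab etas hh' (kn : k.+1 <= n.+1)%N.
rewrite -cofactor_xi // -cofactor_rho //.
set al := _ / _; set be := _ / _.
pose r := h k - al *: (('X - b%:P) * h' k) - be *: (('X - a%:P) * h' k.+1).
have rE : ('X - a%:P) ^+ k * ('X - b%:P) ^+ (n - k) * r
    = node_poly n a b h k
      - (al *: node_poly n.+1 a b h' k + be *: node_poly n.+1 a b h' k.+1).
  rewrite /node_poly /r subSn // subSS -!mul_polyC !exprS; ring.
have ra : root r a.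
  rewrite rootE !(hornerXsubC, hornerD, hornerN, hornerZ, hornerM) subrr /al.
  by apply/eqP; field; rewrite d0 ha0.
have rb : root r b.
  rewrite rootE !(hornerXsubC, hornerD, hornerN, hornerZ, hornerM) subrr /be.
  by apply/eqP; field; rewrite d0' hb0.
apply/eqP; rewrite -subr_eq0 -rE; apply/eqP.
apply: (@sparse_two_nodes_eq0 _ (muntz_exps eta n.+1) k.+1 a (n - k).+1 b) => //.
- by rewrite size_mkseq; lia.
- rewrite rE; apply: sparseD => //; rewrite -scaleN1r; apply/sparseZ/sparseD.
    by apply: sparseZ; apply: hh'.1; exact: leqW.
  by apply: sparseZ; exact: hh'.1.
rewrite !exprSr mulrACA dvdp_mul //.
rewrite Gauss_dvdp ?coprimep_XsubC2 ?dvdp_XsubCl ?ra ?rb //.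
Qed.

End Elevation.

(** * From Muntz functions to polynomials *)
Section MuntzPolynomials.
Variable R : realType.
Implicit Types (f : R -> R) (p : {poly R}) (lam : seq nat).

Lemma gap_exp_inj M nu n :
  sorted geq nu -> (nth 0 nu 0 <= M)%N -> {in gtn n &, injective (gap_exp M nu)}.
Proof.
move=> nus nuM j k _ _; rewrite /gap_exp.
have lt_gap i l : (i < l)%N -> (M - nth 0 nu i + i < M - nth 0 nu l + l)%N.
  move=> il; rewrite -addnS leq_add //.
  by rewrite leq_sub2l // nth_partition // ltnW.
by move=> e; case: (ltngtP j k) => // /lt_gap; rewrite e ltnn.
Qed.

Lemma muntz_sparse n lam f : muntz n lam f ->
  exists2 p, sparse (muntz_exps lam n) p & forall t, 0 < t -> f t = p.[t].
Proof.
case=> c fc; exists (\sum_(i < n.+1) c i *: 'X^(muntz_exp lam i)).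
  apply: sparse_sum => i _; apply/sparseZ/sparseXn/map_f.
  by rewrite mem_iota /= add0n.
move=> t t0; rewrite fc // horner_sum; apply: eq_bigr => i _.
by rewrite hornerZ hornerXn.
Qed.

Lemma sparse_muntz n lam p : sorted geq lam ->
  sparse (muntz_exps lam n) p -> muntz n lam (fun t => p.[t]).
Proof.
move=> lams hp; exists (fun i => p`_(muntz_exp lam i)) => t _.
have inj_e := @gap_exp_inj (nth 0%N lam 0) lam n.+1 lams (leqnn _).
rewrite {1}(sparse_mkseqE inj_e hp) horner_sum; apply: eq_bigr => i _.
by rewrite hornerZ hornerXn.
Qed.

Lemma derive1n_horner f p j t : (forall t, 0 < t -> f t = p.[t]) -> 0 < t ->
  derive1n j f t = p^`(j).[t].
Proof.
move=> fp; elim: j t => [|j IH] t t0; first by rewrite derive1n0 derivn0 fp.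
rewrite derive1nS derivnS derivE !derive1E; apply: near_eq_derive.
by near=> u; apply: IH; near: u; exact: lt_nbhsr.
Unshelve. all: by end_near. Qed.

Lemma horner_derivn_XsubC_exp_mul x k (q : {poly R}) :
  (('X - x%:P) ^+ k * q)^`(k).[x] = k`!%:R * q.[x].
Proof.
elim: k q => [|k IH] q; first by rewrite expr0 !mul1r derivn0.
have [u qu ux] := deriv_XsubC_exp_mul x k q.
by rewrite derivSn qu IH ux mulrA -natrM mulnC factS.
Qed.

(** If [p = (X - x)^k q], its [k]-th derivative at [x] is [k! q(x)]. *)
Lemma vanishes_dvdp k f p x : (forall t, 0 < t -> f t = p.[t]) -> 0 < x ->
  vanishes k f x -> ('X - x%:P) ^+ k %| p.
Proof.
move=> fp x0; elim: k => [|k IH] vk; first by rewrite dvd1p.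
have /dvdpP[q pq] : ('X - x%:P) ^+ k %| p by apply: IH => j jk; apply/vk/leqW.
have := vk k (ltnSn k); rewrite (derive1n_horner _ fp x0) pq mulrC.
rewrite horner_derivn_XsubC_exp_mul => /eqP.
rewrite mulf_eq0 pnatr_eq0 gtn_eqF ?fact_gt0 //= => qx.
by rewrite exprSr dvdp_mul // dvdp_XsubCl.
Qed.

Lemma chebyshev_bernstein_cofactors n lam a b (B : 'I_n.+1 -> R -> R) :
  0 < a -> a < b -> chebyshev_bernstein lam a b B ->
  exists2 h, cb_cofactors n lam a b h
    & forall (k : 'I_n.+1) t, 0 < t -> B k t = (node_poly n a b h k).[t].
Proof.
move=> a0 ab [[hB _] sumB vanB]; have b0 := lt_trans a0 ab.
have /choice[h hh] : forall k : 'I_n.+1, exists h : {poly R},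
    sparse (muntz_exps lam n) (('X - a%:P) ^+ k * ('X - b%:P) ^+ (n - k) * h) /\
    forall t, 0 < t -> B k t = (('X - a%:P) ^+ k * ('X - b%:P) ^+ (n - k) * h).[t].
  move=> k; have [p hp Bp] := muntz_sparse (hB k).
  have [/(vanishes_dvdp Bp a0) pa /(vanishes_dvdp Bp b0) pb] := vanB k.
  have /dvdpP[h ph] : ('X - a%:P) ^+ k * ('X - b%:P) ^+ (n - k) %| p.
    rewrite Gauss_dvdp ?pa // coprimep_expl ?coprimep_expr ?coprimep_XsubC2 //.
    by rewrite subr_eq0 gt_eqF.
  by exists h; rewrite mulrC -ph.
have BE (k : 'I_n.+1) t : 0 < t -> B k t = (node_poly n a b (h \o inord) k).[t].
  by move=> t0; rewrite /node_poly /= inord_val (hh k).2.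
exists (h \o inord) => //; split.
  move=> k kn; have := (hh (inord k)).1.
  by rewrite /node_poly /= inordK.
apply: eq_poly_pos => t t0; rewrite hornerC -(sumB t t0) horner_sum big_mkord.
by apply: eq_bigr => k _; rewrite BE.
Qed.

End MuntzPolynomials.

Theorem theorem8 (R : realType) (n : nat) (lam eta : seq nat) (a b : R)
    (m : nat) (P : R -> 'rV[R]_m)
    (B : 'I_n.+1 -> R -> R) (B' : 'I_n.+2 -> R -> R)
    (Q : 'I_n.+1 -> 'rV[R]_m) (Q' : 'I_n.+2 -> 'rV[R]_m)
    (hn : (1 <= n)%N)
    (hlam : is_partition n lam)
    (heta : dim_elevation R n lam eta)
    (ha : 0 < a) (hab : a < b)
    (hm : (m <= n)%N)
    (hP : muntz_map n lam P)
    (hB : chebyshev_bernstein lam a b B)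
    (hB' : chebyshev_bernstein eta a b B')
    (hPB : forall t : R, 0 < t -> P t = \sum_(k < n.+1) B k t *: Q k)
    (hPB' : forall t : R, 0 < t -> P t = \sum_(k < n.+2) B' k t *: Q' k) :
  [/\ Q' ord0 = Q ord0,
      Q' ord_max = Q ord_max
    & forall k : nat, (1 <= k <= n)%N ->
        Q' (inord k) = rho lam eta a b n k.-1 *: Q (inord k.-1)
                     + xi lam eta a b n k *: Q (inord k)].
Proof.
have [lams _] := hlam; have [[etas _] elev] := heta.
have [h hh Bh] := chebyshev_bernstein_cofactors ha hab hB.
have [h' hh' Bh'] := chebyshev_bernstein_cofactors ha hab hB'.
pose x k := xi lam eta a b n k; pose r k := rho lam eta a b n k.
(* The expected coefficients, written so that the two boundary cases are the
   general formula with one term missing. *)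
pose C (i : nat) : 'rV[R]_m :=
  (if (i <= n)%N then x i *: Q (inord i) else 0)
  + (if (0 < i)%N then r i.-1 *: Q (inord i.-1) else 0).
have PC t : 0 < t -> P t = \sum_(i < n.+2) B' i t *: C i.
  move=> t0; rewrite hPB //; pose v i := (node_poly n.+1 a b h' i).[t].
  transitivity (\sum_(k < n.+1) (x k * v k + r k * v k.+1) *: Q k).
    apply: eq_bigr => k _; have kn : (k <= n)%N by rewrite -ltnS.
    rewrite Bh // (node_poly_elevation ha hab lams etas hh hh' kn).
      by rewrite hornerD !hornerZ.
    have [p hp pE] := muntz_sparse (elev _ (sparse_muntz lams (hh.1 _ kn))).
    by have -> : node_poly n a b h k = p by apply: eq_poly_pos.
  transitivity (\sum_(i < n.+2) v i *: C i); last first.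
    by apply: eq_bigr => i _; rewrite Bh'.
  under [RHS]eq_bigr do rewrite scalerDr.
  rewrite big_split /= [X in _ = X + _]big_ord_recr /= ltnn scaler0 addr0.
  rewrite [X in _ = _ + X]big_ord_recl /= scaler0 add0r -big_split /=.
  apply: eq_bigr => k _; have kn : (k <= n)%N by rewrite -ltnS.
  rewrite kn !scalerA scalerDl [x k * _]mulrC [r k * _]mulrC.
  by rewrite /bump /= add1n /= inord_val.
have Q'C i : Q' i = C i.
  have [[_ uniqB'] _ _] := hB'.
  apply/rowP => j; have [c [_ cu]] := uniqB' _ (elev _ (hP j)).
  have cE (D : 'I_n.+2 -> 'rV[R]_m) :
      (forall t, 0 < t -> P t = \sum_i B' i t *: D i) -> c 0 i = D i 0 j.
    move=> PD; rewrite (cu (\row_i D i 0 j)) ?mxE // => t t0.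
    by rewrite PD // summxE; apply: eq_bigr => k _; rewrite !mxE mulrC.
  by rewrite -(cE Q' hPB') (cE C PC).
have ab0 : a - b != 0 by rewrite subr_eq0 lt_eqF.
have ba0 : b - a != 0 by rewrite subr_eq0 gt_eqF.
split.
- rewrite Q'C /C /= addr0 /x -(cofactor_xi ha hab lams etas hh hh') //.
  have -> : (a - b) * (h' 0).[a] = (h 0).[a].
    apply: (mulfI (expf_neq0 n ab0)); rewrite mulrA -exprSr.
    by rewrite (cofactor_first hh) (cofactor_first hh').
  rewrite divff ?(cofactor_left_neq0 ha hab lams hh) //.
  by rewrite scale1r; congr (Q _); apply: val_inj; rewrite /= inordK.
- rewrite Q'C /C /= ltnn add0r /r -(cofactor_rho ha hab lams etas hh hh') //.
  have -> : (b - a) * (h' n.+1).[b] = (h n).[b].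
    apply: (mulfI (expf_neq0 n ba0)); rewrite mulrA -exprSr.
    by rewrite (cofactor_last hh) (cofactor_last hh').
  rewrite divff ?(cofactor_right_neq0 ha hab lams hh) //.
  by rewrite scale1r; congr (Q _); apply: val_inj; rewrite /= inordK.
move=> k /andP[k0 kn]; rewrite Q'C /C inordK ?ltnS ?leqW //.
by rewrite kn k0 addrC.
Qed.
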